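(* There exists an involution $\Psi$ on the set of labelled tip-augmented plane trees such that for every such tree $T$: the number of singleton leaves of $\Psi(T)$ equals the number of elder non-twin leaves of $T$, the number of elder non-twin leaves of $\Psi(T)$ equals the number of singleton leaves of $T$, and $\Psi(T)$ and $T$ have the same numbers of elder twin leaves, of second leaves, and of younger leaves.
   Context: A plane tree is a rooted tree in which the children of each vertex are linearly ordered (left to right). A labelled plane tree with $m$ vertices is a plane tree whose vertices are bijectively labelled by $\{1,\dots,m\}$. A leaf is a non-root vertex with no children; an interior vertex is a vertex with at least one child. A tip-augmented plane tree is a plane tree in which the leftmost child of every interior vertex is a leaf. Leaves are classified: a singleton leaf is a leaf with no siblings; an elder twin leaf is a leaf that is the leftmost child of its parent and the second child of that parent is also a leaf; an elder non-twin leaf is a leaf that is the leftmost child of its parent and the second child of that parent is not a leaf; a second leaf is a leaf that is the second child of its parent; a younger leaf is a leaf that is neither the first nor the second child of its parent.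
   Formalization: The five equalities are asserted for every tree T except those with exactly two vertices: the one-edge tree has one singleton leaf and no other leaf, and no tip-augmented tree has one elder non-twin leaf but no singleton and no elder twin leaf. *)

(* Defs.v *)
From HB Require Import structures.
From mathcomp Require Import all_boot.

Set Implicit Arguments.
Unset Strict Implicit.
Unset Printing Implicit Defensive.

(** Plane trees whose vertices carry natural numbers; the children of a vertex
    are listed from left to right. *)
Inductive ptree : Type := Node of nat & seq ptree.

Definition label (v : ptree) : nat := let: Node a _ := v in a.
Definition children (v : ptree) : seq ptree := let: Node _ cs := v in cs.

(** A vertex is represented by the subtree rooted at it. *)
Fixpoint vertices (t : ptree) : seq ptree :=
  let: Node _ cs := t in t :: flatten (map vertices cs).

Definition num_vertices (t : ptree) : nat := size (vertices t).

Definition labelled (t : ptree) : bool :=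
  perm_eq (map label (vertices t)) (iota 1 (num_vertices t)).

Definition interior (v : ptree) : bool := ~~ nilp (children v).

(** Leaves are always designated as the [i]-th child (counted from 0) in a list
    [cs] of siblings; in particular the root is never a leaf. *)
Definition leaf_at (cs : seq ptree) (i : nat) : bool :=
  if onth cs i is Some c then ~~ interior c else false.

Definition tip_augmented (t : ptree) : bool :=
  all (fun v => interior v ==> leaf_at (children v) 0) (vertices t).

Definition singleton_leaf (cs : seq ptree) (i : nat) : bool :=
  leaf_at cs i && (size cs == 1).

Definition elder_twin_leaf (cs : seq ptree) (i : nat) : bool :=
  [&& leaf_at cs i, i == 0 & leaf_at cs 1].

(** The second child is required to exist, so that singleton leaves are not
    elder non-twin leaves. *)
Definition elder_nontwin_leaf (cs : seq ptree) (i : nat) : bool :=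
  [&& leaf_at cs i, i == 0, 1 < size cs & ~~ leaf_at cs 1].

Definition second_leaf (cs : seq ptree) (i : nat) : bool :=
  leaf_at cs i && (i == 1).

Definition younger_leaf (cs : seq ptree) (i : nat) : bool :=
  leaf_at cs i && (1 < i).

Definition num_leaves (kind : seq ptree -> nat -> bool) (t : ptree) : nat :=
  \sum_(v <- vertices t) count (kind (children v)) (iota 0 (size (children v))).

Record ltap_tree : Type := LTAPTree {
  tree_of :> ptree;
  tree_ofP : labelled tree_of && tip_augmented tree_of
}.

HB.instance Definition _ := [isSub for tree_of].

(** The one-edge tree is exceptional for the exchange of singleton leaves and
    elder non-twin leaves: its only leaf is a singleton leaf, whereas by the
    next lemma no tip-augmented plane tree has one elder non-twin leaf, no
    singleton leaf and no elder twin leaf. *)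
Lemma singleton_or_twin (t : ptree) : tip_augmented t -> interior t ->
  0 < num_leaves singleton_leaf t + num_leaves elder_twin_leaf t.
Proof.
have [n] := ubnP (num_vertices t); elim: n t => // n IHn [a cs].
rewrite /num_vertices /tip_augmented /num_leaves [vertices _]/= !big_cons.
case: cs => [|c1 [|c2 r]] // lt_n /=.
  by case/andP; rewrite /singleton_leaf => ->.
rewrite !all_cat => /andP[lf /and3P[_ tip2 _]] _.
have [lf2|int2] := boolP (leaf_at [:: c1, c2 & r] 1).
  by rewrite {1}/elder_twin_leaf lf lf2 /= addnA addn_gt0 addnS.
have lt2 : num_vertices c2 < n.
  move: lt_n; rewrite /= !size_cat ltnS; apply: leq_trans.
  by rewrite ltnS addnCA leq_addr.
have := IHn c2 lt2 tip2 (negbNE int2); rewrite !addn_gt0 !big_cat /= !addn_gt0.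
by case/orP=> ->; rewrite !orbT.
Qed.

Lemma one_edge_exception :
  ~ exists Psi : ltap_tree -> ltap_tree, forall T : ltap_tree,
      [/\ num_leaves singleton_leaf (Psi T) = num_leaves elder_nontwin_leaf T,
          num_leaves elder_nontwin_leaf (Psi T) = num_leaves singleton_leaf T
        & num_leaves elder_twin_leaf (Psi T) = num_leaves elder_twin_leaf T].
Proof.
case=> Psi /(_ (@LTAPTree (Node 1 [:: Node 2 [::]]) isT)) [].
case: (Psi _) => t /= /andP[_ tip_t].
rewrite /num_leaves /= !big_cons !big_nil /= -!/(num_leaves _ t) => s0 e1 t0.
have := singleton_or_twin tip_t; rewrite s0 t0.
case: t e1 {tip_t s0 t0} => a [|c cs]; first by rewrite /num_leaves big_seq1.
by move=> _ /(_ isT).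
Qed.

(* Main.v *)
Require Import Defs.
From mathcomp Require Import all_boot.

(** Call a tip-augmented tree big if its root has at least two children. Moving
    down from the root of a big tree through second children, as long as these
    are big, one ends at a vertex whose second child is a leaf or a one-edge
    tree. Hence a big tree is built uniquely from such a minimal one by steps
    which either append a leaf, a one-edge tree or a big tree as the last child
    of the root, or put the tree as second child under a new root whose first
    child is a leaf. The minimal trees and the other steps affect singleton
    leaves and elder non-twin leaves alike, while appending a one-edge tree adds
    just one singleton leaf, and a new root adds just one elder non-twin leaf;
    both involve two new labels. The involution exchanges these two steps. *)

(** * Codes of big trees *)

Inductive code : Type :=
  | Twin of nat & nat & nat
  | Nontwin of nat & nat & nat & nat
  | NewRoot of code & nat & nat
  | AddLeaf of code & nat
  | AddEdge of code & nat & nat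
  | AddTree of code & code.

Definition leaf (a : nat) : ptree := Node a [::].
Definition edge (a b : nat) : ptree := Node a [:: leaf b].
Definition add_child (t d : ptree) : ptree :=
  Node (label t) (rcons (children t) d).

Fixpoint decode (c : code) : ptree :=
  match c with
  | Twin a b d => Node a [:: leaf b; leaf d]
  | Nontwin a b d e => Node a [:: leaf b; edge d e]
  | NewRoot c a b => Node a [:: leaf b; decode c]
  | AddLeaf c a => add_child (decode c) (leaf a)
  | AddEdge c a b => add_child (decode c) (edge a b)
  | AddTree c d => add_child (decode c) (decode d)
  end.

Fixpoint swap (c : code) : code :=
  match c with
  | Twin _ _ _ | Nontwin _ _ _ _ => c
  | NewRoot c a b => AddEdge (swap c) a b
  | AddLeaf c a => AddLeaf (swap c) a
  | AddEdge c a b => NewRoot (swap c) a b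
  | AddTree c d => AddTree (swap c) (swap d)
  end.

Lemma swapK : involutive swap.
Proof. by elim=> //= [c -> | c -> | c -> | c -> d ->]. Qed.

Lemma size_decode (c : code) : 1 < size (children (decode c)).
Proof. by elim: c => //= *; rewrite size_rcons ltnW. Qed.

Lemma interior_decode (c : code) : interior (decode c).
Proof. by rewrite /interior /nilp -lt0n (ltn_trans _ (size_decode c)). Qed.

Lemma add_child_inj (t t' d d' : ptree) :
  add_child t d = add_child t' d' -> t = t' /\ d = d'.
Proof. by case: t t' => [a cs] [a' cs'] [-> /rcons_inj[-> ->]]. Qed.

(** A decoded root has at least two children, so appending one gives at least three. This separates
    the [Add] steps from the constructors whose root has exactly two children. *)
Lemma add_child_decode_neq (c : code) (d x y : ptree) (a : nat) :
  add_child (decode c) d <> Node a [:: x; y].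
Proof.
case=> _ /(congr1 size) /eqP; rewrite size_rcons eqSS => /eqP eq1.
by have := size_decode c; rewrite eq1.
Qed.

Lemma leaf_decode_neq (c : code) (a : nat) : leaf a <> decode c.
Proof. by move=> eq_c; have := size_decode c; rewrite -eq_c. Qed.

Lemma edge_decode_neq (c : code) (a b : nat) : edge a b <> decode c.
Proof. by move=> eq_c; have := size_decode c; rewrite -eq_c. Qed.

(** Once the number of root children has told these two groups apart, the last child (a leaf, an
    edge or a big tree) determines the constructor, and the induction hypotheses recover the
    subcodes. *)
Lemma decode_inj : injective decode.
Proof.
have [[lfN edN] adN] := (leaf_decode_neq, edge_decode_neq, add_child_decode_neq).
elim=> [a b d | a b d e | c IHc a b | c IHc a | c IHc a b | c IHc d IHd].
- case=> //=.
  + by move=> ? ? ? [-> -> ->].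
  + by move=> ? ? ? [_ _] /lfN.
  + by move=> ? ? /esym/adN.
  + by move=> ? ? ? /esym/adN.
  + by move=> ? ? /esym/adN.
- case=> //=.
  + by move=> ? ? ? ? [-> -> -> ->].
  + by move=> ? ? ? [_ _] /edN.
  + by move=> ? ? /esym/adN.
  + by move=> ? ? ? /esym/adN.
  + by move=> ? ? /esym/adN.
- case=> /=.
  + by move=> ? ? ? [_ _] /esym/lfN.
  + by move=> ? ? ? ? [_ _] /esym/edN.
  + by move=> ? ? ? [-> -> /IHc ->].
  + by move=> ? ? /esym/adN.
  + by move=> ? ? ? /esym/adN.
  + by move=> ? ? /esym/adN.
- case=> /=; try by move=> *; exfalso; apply: adN; eassumption.
  + by move=> ? ? /add_child_inj[/IHc-> [->]].
  + by move=> ? ? ? /add_child_inj[].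
  + by move=> ? ? /add_child_inj[_ /lfN].
- case=> /=; try by move=> *; exfalso; apply: adN; eassumption.
  + by move=> ? ? /add_child_inj[].
  + by move=> ? ? ? /add_child_inj[/IHc-> [-> ->]].
  + by move=> ? ? /add_child_inj[_ /edN].
- case=> /=; try by move=> *; exfalso; apply: adN; eassumption.
  + by move=> ? ? /add_child_inj[_ /esym/lfN].
  + by move=> ? ? ? /add_child_inj[_ /esym/edN].
  + by move=> ? ? /add_child_inj[/IHc-> /IHd->].
Qed.

(** * Tip-augmentation and the existence of codes *)

Lemma tip_augmentedE (t : ptree) :
  tip_augmented t =
    (interior t ==> leaf_at (children t) 0) && all tip_augmented (children t).
Proof.
case: t => a cs; rewrite /tip_augmented /=; congr (_ && _).
by elim: cs => //= d cs IHcs; rewrite all_cat IHcs.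
Qed.

(** As [t] is interior, [d] never becomes the first child, so the condition at the root is that of
    [t]. *)
Lemma tip_augmented_add_child (t d : ptree) : interior t ->
  tip_augmented (add_child t d) = tip_augmented t && tip_augmented d.
Proof.
case: t => a [//|c cs] _.
rewrite tip_augmentedE [tip_augmented (Node _ _)]tip_augmentedE.
by rewrite /= all_rcons -!andbA; do !bool_congr; rewrite andbC.
Qed.

Lemma tip_augmented_decode (c : code) : tip_augmented (decode c).
Proof.
elim: c => // [c IHc a b | c IHc a | c IHc a b | c IHc d IHd] /=;
  rewrite ?tip_augmented_add_child ?interior_decode ?IHc //.
by rewrite tip_augmentedE /= IHc.
Qed.

Variant tip_augmented_spec : ptree -> Type :=
  | TipLeaf a : tip_augmented_spec (leaf a)
  | TipEdge a b : tip_augmented_spec (edge a b)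
  | TipBig t of 1 < size (children t) : tip_augmented_spec t.

(** An only child is leftmost, hence a leaf; so a root with one child gives just an edge. *)
Lemma tip_augmentedP (t : ptree) : tip_augmented t -> tip_augmented_spec t.
Proof.
case: t => a [|[b [|x xs]] [|d cs]] //=; try by constructor.
Qed.

Lemma num_vertices_Node (a : nat) (cs : seq ptree) :
  num_vertices (Node a cs) = (\sum_(d <- cs) num_vertices d).+1.
Proof.
by rewrite /num_vertices /= size_flatten /shape -map_comp sumnE big_map.
Qed.

(** Induction on the number of vertices: with three or more root children the last one is removed;
    with two, the second decides between [Twin], [Nontwin] and [NewRoot]. The code is an informative
    witness, from which [Psi] can be defined. *)
Lemma decode_surj (t : ptree) :
  tip_augmented t -> 1 < size (children t) -> {c | decode c = t}.
Proof.
have [n] := ubnP (num_vertices t); elim: n t => // n IHn [a [//|b cs]].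
rewrite num_vertices_Node big_cons ltnS => lt_n tipt.
have /and3P[lfb _ tipcs] :
    [&& ~~ interior b, tip_augmented b & all tip_augmented cs].
  by move: tipt; rewrite tip_augmentedE.
have{lfb tipt} eb: b = leaf (label b) by case: b lfb {lt_n tipt} => ? [].
rewrite eb in lt_n *; move: (label b) lt_n => {eb}b.
elim/last_ind: cs tipcs => [//|r d _]; rewrite all_rcons => /andP[tipd tipr].
rewrite -cats1 big_cat big_seq1 => /= lt_n _.
have lt_d: num_vertices d < n.
  by apply: leq_trans lt_n; rewrite num_vertices_Node ltnS addnA leq_addl.
have def_d := IHn d lt_d tipd.
case: r tipr lt_n => [_ _|x r tipr lt_n].
  case: (tip_augmentedP d tipd) def_d => [e | e f | d' d_gt1] def_d.
  - by exists (Twin a b e).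
  - by exists (Nontwin a b e f).
  - by have [c <-] := def_d d_gt1; exists (NewRoot c a b).
(* Without [d] the root still has two children, and the tree is smaller because [d] has at least one
   vertex. *)
have [||//|c def_c] := IHn (Node a [:: leaf b, x & r]).
- rewrite num_vertices_Node big_cons; apply: leq_trans lt_n.
  rewrite ltnS addnA -[ltnLHS]addn0 ltn_add2l.
  by case: d {tipd lt_d def_d} => e es; rewrite num_vertices_Node.
- by rewrite tip_augmentedE.
have{def_c} def_t e :
  Node a [:: leaf b, x & r ++ [:: e]] = add_child (decode c) e.
  by rewrite def_c cats1.
rewrite def_t.
case: (tip_augmentedP d tipd) def_d => [e | e f | d' d_gt1] def_d.
- by exists (AddLeaf c e).
- by exists (AddEdge c e f).
- by have [c' <-] := def_d d_gt1; exists (AddTree c c').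
Qed.

(** * Preservation of the labelling *)

Definition labels (t : ptree) : seq nat := map label (vertices t).

Lemma labels_Node (a : nat) (cs : seq ptree) :
  labels (Node a cs) = a :: flatten (map labels cs).
Proof. by rewrite /labels /= map_flatten -map_comp. Qed.

Lemma labels_add_child (t d : ptree) :
  labels (add_child t d) = labels t ++ labels d.
Proof.
by case: t => a cs; rewrite !labels_Node map_rcons flatten_rcons.
Qed.

(** [NewRoot] and [AddEdge] contribute the same two labels, listed before or after those of the
    subtree. *)
Lemma perm_labels_swap (c : code) :
  perm_eq (labels (decode (swap c))) (labels (decode c)).
Proof.
elim: c => //= [c IHc a b | c IHc a | c IHc a b | c IHc d IHd];
  rewrite ?labels_add_child ?labels_Node /= ?cats0.
- by rewrite perm_catC /= !perm_cons.
- by rewrite perm_cat2r.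
- by rewrite perm_sym perm_catC /= !perm_cons perm_sym.
- exact: perm_cat.
Qed.

Lemma labelled_swap (c : code) : labelled (decode c) -> labelled (decode (swap c)).
Proof.
have perm_c := perm_labels_swap c; have := perm_size perm_c.
rewrite !size_map /labelled /num_vertices => ->; exact: perm_trans.
Qed.

(** * Leaf counts under the building steps *)

Lemma num_leaves_Node kind (a : nat) (cs : seq ptree) :
  num_leaves kind (Node a cs) =
    count (kind cs) (iota 0 (size cs)) + \sum_(d <- cs) num_leaves kind d.
Proof.
by rewrite /num_leaves /= big_cons /= big_flatten /= big_map.
Qed.

Lemma num_leaves_leaf kind (a : nat) : num_leaves kind (leaf a) = 0.
Proof. by rewrite num_leaves_Node big_nil. Qed.

Lemma num_leaves_edge kind (a b : nat) :
  num_leaves kind (edge a b) = kind [:: leaf b] 0.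
Proof. by rewrite num_leaves_Node big_seq1 num_leaves_leaf /= !addn0. Qed.

Lemma num_leaves_two kind (a b : nat) (d : ptree) :
  num_leaves kind (Node a [:: leaf b; d]) =
    kind [:: leaf b; d] 0 + kind [:: leaf b; d] 1 + num_leaves kind d.
Proof.
by rewrite num_leaves_Node big_cons big_seq1 num_leaves_leaf /= addn0.
Qed.

(** If the new child does not change the classes of its siblings, the only new leaves of the given
    kind lie inside [d] or are [d] itself. *)
Lemma num_leaves_add_child kind (t d : ptree) :
    (forall i, i < size (children t) ->
       kind (rcons (children t) d) i = kind (children t) i) ->
  num_leaves kind (add_child t d) =
    num_leaves kind t + num_leaves kind d
    + kind (rcons (children t) d) (size (children t)).
Proof.
case: t => a cs /= kind_cs; rewrite !num_leaves_Node size_rcons.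
rewrite -cats1 big_cat big_seq1 -addn1 iotaD count_cat cats1 /= addn0.
rewrite (@eq_in_count _ _ (kind cs)); last first.
  by move=> i; rewrite mem_iota => /kind_cs.
by rewrite addnAC -!addnA.
Qed.

Lemma leaf_at_rcons (cs : seq ptree) (d : ptree) (i : nat) :
  i < size cs -> leaf_at (rcons cs d) i = leaf_at cs i.
Proof.
by elim: cs i => //= c cs IHcs [|i] //=; rewrite ltnS => /IHcs.
Qed.

Lemma leaf_at_last (cs : seq ptree) (d : ptree) :
  leaf_at (rcons cs d) (size cs) = ~~ interior d.
Proof. by elim: cs. Qed.

Section AddChild.

Variables (t d : ptree).
Hypothesis big_t : 1 < size (children t).

(** Two children already present exclude singletons at the root and settle the class of its first
    child. In this and the following lemmas the new child comes third or later, so it can itself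
    count only as a younger leaf. *)
Lemma singleton_add_child : num_leaves singleton_leaf (add_child t d) =
  num_leaves singleton_leaf t + num_leaves singleton_leaf d.
Proof.
rewrite num_leaves_add_child /singleton_leaf => [|i i_lt]; rewrite size_rcons.
  by rewrite eqSS eqn0Ngt (ltnW big_t) andbF addn0.
by rewrite eqSS eqn0Ngt (ltnW big_t) gtn_eqF // !andbF.
Qed.

Lemma elder_twin_add_child : num_leaves elder_twin_leaf (add_child t d) =
  num_leaves elder_twin_leaf t + num_leaves elder_twin_leaf d.
Proof.
rewrite num_leaves_add_child /elder_twin_leaf => [|i i_lt].
  by rewrite eqn0Ngt (ltnW big_t) andbF addn0.
by rewrite !leaf_at_rcons.
Qed.

Lemma elder_nontwin_add_child : num_leaves elder_nontwin_leaf (add_child t d) =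
  num_leaves elder_nontwin_leaf t + num_leaves elder_nontwin_leaf d.
Proof.
rewrite num_leaves_add_child /elder_nontwin_leaf => [|i i_lt].
  by rewrite eqn0Ngt (ltnW big_t) andbF addn0.
by rewrite !leaf_at_rcons // size_rcons big_t ltnW.
Qed.

Lemma second_add_child : num_leaves second_leaf (add_child t d) =
  num_leaves second_leaf t + num_leaves second_leaf d.
Proof.
rewrite num_leaves_add_child /second_leaf => [|i i_lt].
  by rewrite gtn_eqF // andbF addn0.
by rewrite leaf_at_rcons.
Qed.

Lemma younger_add_child : num_leaves younger_leaf (add_child t d) =
  num_leaves younger_leaf t + num_leaves younger_leaf d + ~~ interior d.
Proof.
rewrite num_leaves_add_child /younger_leaf => [|i i_lt].
  by rewrite leaf_at_last big_t andbT.
by rewrite leaf_at_rcons.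
Qed.

End AddChild.

(** The minimal trees are balanced: [Twin] has no leaf of either exchanged kind, [Nontwin] has one
    of each. *)
Lemma num_leaves_swap (c : code) :
  [/\ num_leaves singleton_leaf (decode (swap c))
        = num_leaves elder_nontwin_leaf (decode c),
      num_leaves elder_nontwin_leaf (decode (swap c))
        = num_leaves singleton_leaf (decode c),
      num_leaves elder_twin_leaf (decode (swap c))
        = num_leaves elder_twin_leaf (decode c),
      num_leaves second_leaf (decode (swap c))
        = num_leaves second_leaf (decode c)
    & num_leaves younger_leaf (decode (swap c))
        = num_leaves younger_leaf (decode c)].
Proof.
pose add_childE := (singleton_add_child, elder_twin_add_child,
  elder_nontwin_add_child, second_add_child, younger_add_child).
pose baseE := (num_leaves_two, num_leaves_leaf, num_leaves_edge).
elim: c => [a b d|a b d e|c IHc a b|c IHc a|c IHc a b|c IHc d IHd] /=;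
  rewrite ?add_childE ?size_decode // ?baseE //; case: IHc => -> -> -> -> ->.
(* Since [decode c] is interior, the first child of the new root is elder non-twin; on the swapped
   side the appended edge brings one singleton leaf. *)
- by rewrite /singleton_leaf /elder_twin_leaf /elder_nontwin_leaf
  /second_leaf /younger_leaf /leaf_at /= interior_decode /= !addn0 add0n addnC.
- by [].
- by rewrite /singleton_leaf /elder_twin_leaf /elder_nontwin_leaf
  /second_leaf /younger_leaf /leaf_at /= interior_decode /= !addn0 add0n addnC.
- by case: IHd => -> -> -> -> ->; rewrite !interior_decode.
Qed.

(** * The involution on labelled trees *)

Lemma code_of (T : ltap_tree) :
  {o : option code |
     if o is Some c then decode c = T else size (children T) <= 1}.
Proof.
case: (leqP (size (children T)) 1) => [small_T | big_T]; first by exists None.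
have /andP[_ tipT] := tree_ofP T.
by have [c def_T] := decode_surj T tipT big_T; exists (Some c).
Qed.

(** The default [T] of [insubd] is never reached, since swapping keeps the tree labelled and
    tip-augmented. *)
Definition Psi (T : ltap_tree) : ltap_tree :=
  if sval (code_of T) is Some c then insubd T (decode (swap c)) else T.

Lemma Psi_decode (T : ltap_tree) (c : code) :
  decode c = T -> tree_of (Psi T) = decode (swap c).
Proof.
move=> def_T; rewrite /Psi; case: (code_of T) => [[c'|]] /= => [|small_T].
  (* By injectivity the code chosen by [code_of] is [c]. *)
  rewrite -def_T => /decode_inj->; apply: (@insubdK _ _ ltap_tree).
  have /andP[labT _] := tree_ofP T; rewrite -def_T in labT.
  by rewrite unfold_in labelled_swap // tip_augmented_decode.
by have := size_decode c; rewrite def_T ltnNge small_T.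
Qed.

Lemma Psi_small (T : ltap_tree) : size (children T) <= 1 -> Psi T = T.
Proof.
move=> small_T; rewrite /Psi; case: (code_of T) => [[c|]] //= def_T.
by have := size_decode c; rewrite def_T ltnNge small_T.
Qed.

Theorem theorem4p2 :
  exists Psi : ltap_tree -> ltap_tree,
    involutive Psi /\
    forall T : ltap_tree, num_vertices T <> 2 ->
      [/\ num_leaves singleton_leaf (Psi T) = num_leaves elder_nontwin_leaf T,
          num_leaves elder_nontwin_leaf (Psi T) = num_leaves singleton_leaf T,
          num_leaves elder_twin_leaf (Psi T) = num_leaves elder_twin_leaf T,
          num_leaves second_leaf (Psi T) = num_leaves second_leaf T
        & num_leaves younger_leaf (Psi T) = num_leaves younger_leaf T].
Proof.
exists Psi; split=> [T | T T_neq2].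
  have [[c def_T | small_T]] := code_of T.
    (* [Psi T] has the code [swap c], so applying [Psi] again decodes [swap (swap c)]. *)
    apply: val_inj => /=; rewrite (Psi_decode _ (swap c)) ?swapK //.
    by rewrite (Psi_decode _ c).
  by rewrite !Psi_small.
have [big_T | small_T] := ltnP 1 (size (children T)).
  have /andP[_ tipT] := tree_ofP T.
  have [c def_T] := decode_surj T tipT big_T.
  by rewrite (Psi_decode T c def_T) -def_T; apply: num_leaves_swap.
rewrite Psi_small //.
have /andP[_ tipT] := tree_ofP T.
(* Only the single vertex, which has no leaves, survives: an edge has two vertices, against
   [T_neq2]. *)
case: (tip_augmentedP T tipT) T_neq2 small_T => [a | a b | t big_t] //.
by rewrite !num_leaves_leaf.
by rewrite leqNgt big_t.
Qed.
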